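(* Let $d=d(n)$ be an integer-valued function of $n$ with $d(n)\ge 1$ for all $n$ and $d(n)=o(n^{1/3})$ as $n\to\infty$. Then there exists $N$ such that for all integers $n\ge N$, writing $d=d(n)$, for each graph $G\in\mathcal G_n(d)$ that is not isomorphic to $K^*_{d,n-d}$ we have $$\mathbb P(X(G)\ge t)<\mathbb P(X(K^*_{d,n-d})\ge t)\quad\text{for each integer } t=3,\ldots,n-d,$$ and if moreover $\alpha(G)<n-d$ then this inequality holds also for $t=1$ and $t=2$.
   Context: Graphs are finite and simple. For integers $n$ and $d\ge 0$, $\mathcal G_n(d)$ denotes the set of graphs with $n$ vertices and minimum degree at least $d$. $\alpha(G)$ is the independence number of $G$ (the maximum size of an independent set). $K^*_{a,b}$ denotes the graph obtained from the disjoint union of a complete graph on $a$ vertices and an edgeless graph on $b$ vertices by adding all edges between the two vertex sets. $X(G)$ denotes the random variable equal to the size of an independent set chosen uniformly at random from the set of all independent sets of $G$ (including the empty set). *)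

(* Defs.v *)
From HB Require Import structures.
From mathcomp Require Import all_boot all_order all_algebra.
From mathcomp Require Import all_classical all_reals all_analysis.

Set Implicit Arguments.
Unset Strict Implicit.
Unset Printing Implicit Defensive.

Import Order.TTheory GRing.Theory Num.Theory.
Import numFieldNormedType.Exports.

Local Open Scope ring_scope.

Record sgraph := SGraph {
  vertex :> finType;
  adj : rel vertex;
  adj_sym : symmetric adj;
  adj_irrefl : irreflexive adj }.

Definition degree (G : sgraph) (v : G) : nat := #|[set w : G | adj v w]|.

Definition min_degree_class (n d : nat) (G : sgraph) : Prop :=
  #|G| = n /\ (forall v : G, (d <= degree v)%N).

Definition isomorphic (G H : sgraph) : Prop :=
  exists2 f : G -> H, bijective f & forall x y : G, adj (f x) (f y) = adj x y.

Definition independent (G : sgraph) (S : {set G}) : bool :=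
  [forall x in S, forall y in S, ~~ adj x y].

Definition indep_sets (G : sgraph) : {set {set G}} :=
  [set S : {set G} | independent S].

Definition independence_number (G : sgraph) : nat :=
  (\max_(S in indep_sets G) #|S|)%N.

Definition Kstar_adj (a b : nat) : rel ('I_a + 'I_b) := fun x y =>
  match x, y with
  | inl i, inl j => i != j
  | inr _, inr _ => false
  | _, _ => true
  end.

Lemma Kstar_adj_sym (a b : nat) : symmetric (@Kstar_adj a b).
Proof. by case=> [i|i] [j|j] //=; rewrite eq_sym. Qed.

Lemma Kstar_adj_irrefl (a b : nat) : irreflexive (@Kstar_adj a b).
Proof. by case=> i //=; rewrite eqxx. Qed.

Definition Kstar (a b : nat) : sgraph :=
  SGraph (@Kstar_adj_sym a b) (@Kstar_adj_irrefl a b).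

(* Probability of the event [E] for a uniformly random element of [A]; a
   probability only for nonempty [A], and [indep_sets G] contains [set0]. *)
Definition unif_prob (R : realType) (T : finType) (A : {set T}) (E : pred T)
    : R :=
  #|[set x in A | E x]|%:R / #|A|%:R.

Definition indep_size (G : sgraph) (S : {set G}) : nat := #|S|.

Definition prob_indep_size_ge (R : realType) (G : sgraph) (t : nat) : R :=
  unif_prob R (indep_sets G) (fun S => (t <= indep_size S)%N).

(* Main.v *)
Require Import Defs.
From HB Require Import structures.
From mathcomp Require Import all_boot all_order all_algebra.
From mathcomp Require Import all_classical all_reals all_analysis.
From mathcomp Require Import fintype finset zify.

(** Write [m = n - d], and let [a k] be the number of independent [k]-sets of [G].
    A nonempty independent set has at least [d] neighbours, so
    [(k+1) a(k+1) <= (m-k) a k]: the ratio [a k / 'C(m, k)] is nonincreasing for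
    [k >= 1], and [K*] attains ['C(m, k)] for [k >= 2].

    If [alpha(G) < m], then [G] has fewer than [2 ^ m] independent sets: either a
    matching of size [3d] already costs the factor [(3/4) ^ 3d < 2 ^ - d], or some
    [6d] vertices cover all edges, and then at least [d] of them have high degree.
    Nearly all independent sets avoid these, and the vertices that remain are fewer
    than [m], or are [m] in number and span an edge.  Together with the monotone
    ratio, this bound on the total bounds every tail from level [t >= 2].

    If [alpha(G) >= m], then [G] is the join of an edgeless graph on [m] vertices
    with a noncomplete graph [H] on [d] vertices.  Its additional independent sets
    come from [H], and at least one of them has size [2 < t]; this lowers the tail
    probability because almost all subsets of an [m]-set have size at least [d], and
    only levels [t <= d] gain anything from [H]. *)

Set Implicit Arguments.
Unset Strict Implicit.
Unset Printing Implicit Defensive.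

Import Order.TTheory GRing.Theory Num.Theory.
Import numFieldNormedType.Exports.

Local Open Scope nat_scope.

(** * Independent sets and their numbers by size *)

Lemma independentP (G : sgraph) (S : {set G}) :
  reflect {in S &, forall x y, ~~ adj x y} (independent S).
Proof.
apply: (iffP forall_inP) => [h x y xS yS|h x xS].
  by have /forall_inP := h x xS; apply.
by apply/forall_inP => y; apply: h.
Qed.

Lemma sub_independent (G : sgraph) (A B : {set G}) :
  A \subset B -> independent B -> independent A.
Proof.
move=> /subsetP sAB /independentP iB; apply/independentP => x y xA yA.
by apply: iB; apply: sAB.
Qed.

Lemma independent0 (G : sgraph) : independent (set0 : {set G}).
Proof. by apply/independentP => x y; rewrite inE. Qed.

Lemma independent1 (G : sgraph) (x : G) : independent [set x].
Proof. by apply/independentP => y z /set1P-> /set1P->; rewrite adj_irrefl. Qed.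

Lemma independentPn (G : sgraph) (S : {set G}) :
  ~~ independent S -> exists x y, [/\ x \in S, y \in S & adj x y].
Proof.
case/forall_inPn => x xS /forall_inPn [y yS].
by rewrite negbK => xy; exists x, y.
Qed.

Definition indep_count (G : sgraph) (k : nat) : nat :=
  #|[set S in indep_sets G | #|S| == k]|.

Lemma card_level_sum (T : finType) (A : {set T}) (f : T -> nat) (t N : nat) :
  (forall x, f x <= N) ->
  #|[set x in A | t <= f x]| =
    \sum_(t <= k < N.+1) #|[set x in A | f x == k]|.
Proof.
move=> fN.
under eq_bigr => k _ do rewrite -sum1dep_card big_mkcondr.
rewrite exchange_big -sum1dep_card big_mkcondr /=.
apply: eq_bigr => x _.
under eq_bigr => k _ do rewrite eq_sym.
by rewrite -big_mkcond big_nat1_eq ltnS fN andbT.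
Qed.

Lemma indep_tailE (G : sgraph) (t : nat) :
  #|[set S in indep_sets G | t <= indep_size S]| =
    \sum_(t <= k < #|G|.+1) indep_count G k.
Proof. by rewrite (card_level_sum _ _ (N := #|G|)) // => S; apply: max_card. Qed.

Lemma card_indep_setsE (G : sgraph) :
  #|indep_sets G| = \sum_(0 <= k < #|G|.+1) indep_count G k.
Proof. by rewrite -indep_tailE; apply: eq_card => S; rewrite !inE andbT. Qed.

Lemma indep_count0 (G : sgraph) : indep_count G 0 = 1.
Proof.
rewrite -(cards1 (set0 : {set G})); apply: eq_card => S; rewrite !inE cards_eq0.
by case: eqP => [->|_]; rewrite ?independent0 ?andbF.
Qed.

Lemma indep_count1 (G : sgraph) : indep_count G 1 = #|G|.
Proof.
rewrite -cardsT -(card_imset _ set1_inj); apply: eq_card => S; rewrite !inE.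
apply/andP/imsetP => [[_ /cards1P[x ->]]|[x _ ->]]; first by exists x.
by rewrite independent1 cards1.
Qed.

(** * Monotone ratios to binomials and the comparison of tails *)

(* Each independent [k]-set has at least [d] neighbours outside itself, hence
   at most [n - d - k] one-vertex extensions. *)
Lemma indep_count_step (n d : nat) (G : sgraph) (k : nat) :
  min_degree_class n d G -> 0 < k ->
  k.+1 * indep_count G k.+1 <= (n - d - k) * indep_count G k.
Proof.
move=> [nG dG] k_gt0.
(* Double counting: deleting the marked vertex maps [P] injectively into [Q]. *)
pose P := [set p : {set G} * G |
  [&& independent p.1, #|p.1| == k.+1 & p.2 \in p.1]].
pose Q := [set p : {set G} * G |
  [&& independent p.1, #|p.1| == k & (p.2 \notin p.1) && independent (p.2 |: p.1)]].
have PE : #|P| = k.+1 * indep_count G k.+1.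
  rewrite -sum1dep_card.
  rewrite (eq_bigl (fun p : {set G} * G =>
    (p.1 \in [set S in indep_sets G | #|S| == k.+1]) && (p.2 \in p.1))); last first.
    by move=> p; rewrite !inE andbA.
  rewrite -(pair_big_dep (fun S => S \in [set S in indep_sets G | #|S| == k.+1])
     (fun S x => x \in S) (fun _ _ => 1)) /=.
  rewrite (eq_bigr (fun _ => k.+1)) ?sum_nat_const ?(mulnC k.+1) // => S.
  by rewrite !inE sum1_card => /andP[_ /eqP].
have QE : #|Q| <= (n - d - k) * indep_count G k.
  rewrite -sum1dep_card.
  rewrite (eq_bigl (fun p : {set G} * G =>
    (p.1 \in [set S in indep_sets G | #|S| == k]) &&
    ((p.2 \notin p.1) && independent (p.2 |: p.1)))); last first.
    by move=> p; rewrite !inE andbA.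
  rewrite -(pair_big_dep (fun S => S \in [set S in indep_sets G | #|S| == k])
     (fun S x => (x \notin S) && independent (x |: S)) (fun _ _ => 1)) /=.
  rewrite mulnC -sum_nat_const; apply: leq_sum => S.
  rewrite !inE sum1dep_card => /andP[/independentP iS /eqP kS].
  have /card_gt0P[x xS] : 0 < #|S| by rewrite kS.
  have disj : [disjoint S & [set w : G | adj x w]].
    by rewrite disjoint_subset; apply/subsetP => y yS; rewrite !inE iS.
  have -> : n - d - k = n - (k + d) by rewrite -subnDA addnC.
  apply: (@leq_trans #|~: (S :|: [set w : G | adj x w])|).
    apply/subset_leq_card/subsetP => y; rewrite !inE => /andP[yS /independentP i].
    by rewrite negb_or yS i ?inE ?eqxx ?xS ?orbT.
  rewrite (cardsCs (~: _)) setCK nG.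
  have := leq_card_setU S [set w : G | adj x w].
  rewrite disj => /leqifP/eqP ->.
  by rewrite kS leq_sub2l // leq_add2l dG.
rewrite -PE (leq_trans _ QE) //.
pose f (p : {set G} * G) := (p.1 :\ p.2, p.2).
have f_inj : {in P &, injective f}.
  move=> [S x] [T y]; rewrite !inE /= => /and3P[_ _ xS] /and3P[_ _ yT] [ST xy].
  by rewrite -(setD1K xS) ST xy (setD1K yT).
rewrite -(card_in_imset f_inj); apply/subset_leq_card/subsetP => _ /imsetP[[S x] + ->].
rewrite !inE /= => /and3P[iS /eqP kS xS].
rewrite (sub_independent (subsetDl _ _) iS) eqxx /= setD1K // iS andbT.
by have := cardsD1 x S; rewrite xS kS add1n => -[<-].
Qed.

Lemma leq_sum_nat (m n : nat) (F H : nat -> nat) :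
  (forall k, m <= k < n -> F k <= H k) ->
  \sum_(m <= k < n) F k <= \sum_(m <= k < n) H k.
Proof. by move=> FH; rewrite big_nat [leqRHS]big_nat leq_sum. Qed.

(** Binomials satisfy the hypothesis with equality. The cross-multiplied form also covers [k >= m],
    where truncated subtraction forces [a k.+1 = 0]. *)
Lemma ratio_mono (m : nat) (a : nat -> nat) :
  (forall k, 0 < k -> k.+1 * a k.+1 <= (m - k) * a k) ->
  forall j k, 0 < j -> j <= k -> a k * 'C(m, j) <= 'C(m, k) * a j.
Proof.
move=> step j k j_gt0; elim: k => [|k IH]; first by case: j j_gt0.
rewrite leq_eqVlt => /predU1P[<-|]; first by rewrite mulnC.
rewrite ltnS => le_jk; have {}IH := IH le_jk.
have k_gt0 := leq_trans j_gt0 le_jk.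
have := step k k_gt0; have [lt_km|le_mk] := ltnP k m; last first.
  have /eqP-> : m - k == 0 by rewrite subn_eq0.
  by rewrite mul0n leqn0 muln_eq0 /= => /eqP->.
have := mul_bin_left m k => binE stepk.
rewrite -(@leq_pmul2l k.+1) // !mulnA binE.
apply: (@leq_trans ((m - k) * a k * 'C(m, j))); first by rewrite leq_mul2r stepk orbT.
by rewrite -!mulnA leq_mul2l IH orbT.
Qed.

(* If [a t <= 'C(m, t)], compare termwise above [t]; otherwise [a] exceeds the
   binomials below [t], and the comparison of the sums from [2] passes to the tail. *)
Lemma tail_lt (m N : nat) (a : nat -> nat) (t : nat) :
  (forall j k, 0 < j -> j <= k -> a k * 'C(m, j) <= 'C(m, k) * a j) ->
  m <= N -> a m = 0 -> 2 <= t <= m ->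
  \sum_(2 <= k < N.+1) a k < \sum_(2 <= k < N.+1) 'C(m, k) ->
  \sum_(t <= k < N.+1) a k < \sum_(t <= k < N.+1) 'C(m, k).
Proof.
move=> ratio mN am0 /andP[t_ge2 tm].
have ct_gt0 : 0 < 'C(m, t) by rewrite bin_gt0.
have tN : t <= N.+1 by rewrite leqW // (leq_trans tm).
have t_gt0 : 0 < t by apply: leq_trans t_ge2.
rewrite !(big_cat_nat t_ge2 tN) /=.
have [le_t|/ltnW lt_t] := leqP (a t) 'C(m, t); last first.
  have : \sum_(2 <= k < t) 'C(m, k) <= \sum_(2 <= k < t) a k.
    apply: leq_sum_nat => j /andP[j2 jt]; rewrite -(leq_pmul2l ct_gt0).
    apply: leq_trans (ratio j t _ _) => //; last exact: ltnW.
    - by rewrite leq_mul2r lt_t orbT.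
    - exact: leq_trans j2.
  lia.
move=> _.
have le_k k : t <= k -> a k <= 'C(m, k).
  move=> tk; rewrite -(leq_pmul2r ct_gt0).
  by apply: leq_trans (ratio t k _ tk) _ => //; rewrite leq_mul2l le_t orbT.
(* Strictness comes from level [m], where [a m = 0] but ['C(m, m) = 1]. *)
have mN1 : m <= N.+1 by rewrite leqW.
rewrite !(big_cat_nat tm mN1) /= !(@big_ltn _ _ _ m) ?ltnS // am0 binn.
rewrite add0n add1n addnS ltnS leq_add //.
  by apply: leq_sum_nat => k /andP[tk _]; apply: le_k.
by apply: leq_sum_nat => k /andP[mk _]; apply: le_k; apply: leq_trans mk; apply: ltnW.
Qed.

(** * Binomial sums *)

Lemma sum_bin (m N : nat) : m <= N -> \sum_(0 <= k < N.+1) 'C(m, k) = 2 ^ m.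
Proof.
move=> mN; rewrite (@big_cat_nat _ _ _ m.+1) //=.
have -> : \sum_(m.+1 <= k < N.+1) 'C(m, k) = 0.
  by rewrite big_nat big1 // => k /andP[mk _]; apply: bin_small.
rewrite addn0 big_mkord -[2]/(1 + 1) expnDn.
by apply: eq_bigr => i _; rewrite !exp1n !muln1.
Qed.

(** The quotient [(m - i) / (i + 1)] of consecutive binomials is at least 2 while
    [3 (i + 1) <= m]. *)
Lemma bin_shift (m k j : nat) : 3 * (k + j) <= m -> 2 ^ j * 'C(m, k) <= 'C(m, k + j).
Proof.
elim: j => [|j IH] h; first by rewrite mul1n addn0.
rewrite expnS -mulnA addnS.
apply: (@leq_trans (2 * 'C(m, k + j))); first by rewrite leq_pmul2l // IH //; lia.
rewrite -(@leq_pmul2l (k + j).+1) // mul_bin_left mulnA leq_mul2r; apply/orP; right.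
lia.
Qed.

(** Shifting the indices up by [j] gains [2 ^ j] termwise, and the shifted terms are part of row
    [m], whose sum is [2 ^ m]. *)
Lemma sum_bin_small (m d j : nat) : 3 * (d + j) <= m ->
  2 ^ j * \sum_(0 <= k < d) 'C(m, k) <= 2 ^ m.
Proof.
move=> h; rewrite -(sum_bin (leqnn m)) big_distrr /=.
apply: (@leq_trans (\sum_(0 <= k < d) 'C(m, k + j))).
  by apply: leq_sum_nat => k /andP[_ kd]; apply: bin_shift; lia.
have -> : \sum_(0 <= k < d) 'C(m, k + j) = \sum_(j <= k < d + j) 'C(m, k).
  by rewrite -{2}[j]add0n big_addn addnK.
rewrite (@big_cat_nat _ _ _ j 0 m.+1) //=; last by lia.
rewrite (@big_cat_nat _ _ _ (d + j) j m.+1) /=; [|lia|lia].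
by rewrite addnCA leq_addr.
Qed.

(** * Upper bounds for the number of independent sets *)

(** The independent sets of the subgraph induced on [W], kept as sets of vertices of [G] so that no
    new graph is built. *)
Definition indep_in (G : sgraph) (W : {set G}) : {set {set G}} :=
  [set S : {set G} | independent S & S \subset W].

Lemma card_indep_in_le (G : sgraph) (W : {set G}) : #|indep_in W| <= 2 ^ #|W|.
Proof.
rewrite -card_powerset; apply/subset_leq_card/subsetP => S.
by rewrite !inE => /andP[].
Qed.

(** An independent set contains [x] only, [y] only, or neither. *)
Lemma card_indep_in_edge (G : sgraph) (W : {set G}) (x y : G) :
  x \in W -> y \in W -> adj x y ->
  #|indep_in W| <= 3 * #|indep_in (W :\ x :\ y)|.
Proof.
move=> xW yW xy; set D := indep_in (_ :\ _).
have sub : indep_in W \subset D :|: ((setU [set x]) @: D :|: (setU [set y]) @: D).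
  apply/subsetP => S; rewrite !inE => /andP[iS sSW].
  have drop (z : G) : S :\ z \subset W :\ x :\ y -> S :\ z \in D.
    by move=> ss; rewrite inE ss (sub_independent (subsetDl _ _) iS).
  have [xS|xS] := boolP (x \in S).
    have yS : y \notin S.
      by apply: contraL xy => yS; have /independentP := iS; apply.
    rewrite -{3}(setD1K xS) imset_f ?orbT // drop // !subsetD1 !inE !eqxx (negbTE yS) /=.
    by rewrite andbF (subset_trans (subsetDl _ _)).
  have [yS|yS] := boolP (y \in S).
    rewrite -{4}(setD1K yS) (imset_f (setU [set y])) ?orbT //.
    rewrite drop // !subsetD1 !inE !eqxx.
    by rewrite (negbTE xS) /= andbF (subset_trans (subsetDl _ _)).
  by rewrite iS !subsetD1 xS yS sSW.
apply: leq_trans (subset_leq_card sub) _.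
apply: leq_trans (leq_card_setU _ _) _; rewrite mulSn leq_add2l.
apply: leq_trans (leq_card_setU _ _) _; rewrite mulSn mul1n.
by rewrite leq_add // leq_imset_card.
Qed.

Lemma card_setD2 (T : finType) (W : {set T}) (x y : T) :
  x \in W -> y \in W -> x != y -> #|W| = (#|W :\ x :\ y|).+2.
Proof.
by move=> xW yW xy; rewrite (cardsD1 x W) xW (cardsD1 y (W :\ x)) !inE eq_sym xy yW.
Qed.

Lemma adj_neq (G : sgraph) (x y : G) : adj x y -> x != y.
Proof. by apply: contraTneq => ->; rewrite adj_irrefl. Qed.

Lemma card_indep_in_dependent (G : sgraph) (W : {set G}) :
  ~~ independent W -> 4 * #|indep_in W| <= 3 * 2 ^ #|W|.
Proof.
case/independentPn => x [y [xW yW xy]].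
have := card_indep_in_edge xW yW xy; have := card_indep_in_le (W :\ x :\ y).
by rewrite (card_setD2 xW yW (adj_neq xy)) !expnS; lia.
Qed.

(* Greedy matching: either [W] contains [k] disjoint edges, each costing a
   factor [3/4], or the ends of fewer than [k] edges cover all edges in [W]. *)
Lemma matching_or_cover (G : sgraph) (k : nat) (W : {set G}) :
  4 ^ k * #|indep_in W| <= 3 ^ k * 2 ^ #|W| \/
  exists2 U : {set G}, #|U| <= 2 * k & independent (W :\: U).
Proof.
elim: k W => [|k IH] W; first by left; rewrite !mul1n card_indep_in_le.
have [iW|] := boolP (independent W).
  by right; exists set0; rewrite ?cards0 ?setD0.
case/independentPn => x [y [xW yW xy]].
have [le_k|[U cU iU]] := IH (W :\ x :\ y).
  left; have := card_indep_in_edge xW yW xy.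
  rewrite (card_setD2 xW yW (adj_neq xy)) !expnS -!mulnA => le_e.
  apply: (@leq_trans (4 * (3 * (4 ^ k * #|indep_in (W :\ x :\ y)|)))).
    by rewrite leq_pmul2l // mulnCA leq_pmul2l ?expn_gt0.
  by rewrite mulnCA leq_pmul2l // -[4]/(2 * 2) -!mulnA !(mulnCA _ 2) !leq_pmul2l.
right; exists (x |: (y |: U)); last by rewrite !setDDl in iU.
by rewrite !cardsU1; do 2!case: (_ \notin _); lia.
Qed.

(** Apart from [v], such a set avoids [v] and all its neighbours. *)
Lemma card_indep_containing (G : sgraph) (v : G) :
  #|[set S in indep_sets G | v \in S]| <= 2 ^ (#|G| - (degree v).+1).
Proof.
have <- : #|~: (v |: [set w : G | adj v w])| = #|G| - (degree v).+1.
  by rewrite cardsCs setCK cardsU1 inE adj_irrefl.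
rewrite -card_powerset; set P := powerset _.
apply: leq_trans (leq_imset_card (setU [set v]) P).
apply/subset_leq_card/subsetP => S; rewrite !inE => /andP[/independentP iS vS].
apply/imsetP; exists (S :\ v); last by rewrite setD1K.
rewrite inE; apply/subsetP => w; rewrite !inE => /andP[wv wS].
by rewrite negb_or wv iS.
Qed.

Lemma card_bigcup_le (T I : finType) (P : pred I) (F : I -> {set T}) :
  #|\bigcup_(i | P i) F i| <= \sum_(i | P i) #|F i|.
Proof.
elim/big_rec2: _ => [|i s A _ le_A]; first by rewrite cards0.
by apply: leq_trans (leq_card_setU _ _) _; rewrite leq_add2l.
Qed.

Lemma card_indep_in_setC_le (G : sgraph) (H : {set G}) :
  #|indep_sets G| <= #|indep_in (~: H)| +
    \sum_(v in H) #|[set S in indep_sets G | v \in S]|.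
Proof.
have sub : indep_sets G \subset indep_in (~: H) :|:
    \bigcup_(v in H) [set S in indep_sets G | v \in S].
  apply/subsetP => S iS; rewrite inE.
  have [sSH|/subsetPn[v vS]] := boolP (S \subset ~: H).
    by rewrite inE sSH andbT; rewrite inE in iS; rewrite iS.
  rewrite inE negbK => vH; apply/orP; right; apply/bigcupP; exists v => //.
  by rewrite inE iS.
apply: leq_trans (subset_leq_card sub) _.
apply: leq_trans (leq_card_setU _ _) _; rewrite leq_add2l.
exact: card_bigcup_le.
Qed.

(* The high-degree vertices of a small vertex cover number at least [d], since
   the low-degree ones meet few vertices; independent sets through a high-degree
   vertex are rare. *)
Lemma card_indep_sets_lt (n d : nat) (G : sgraph) :
  0 < d -> 12 * d ^ 2 + 30 * d < n -> min_degree_class n d G ->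
  (forall S : {set G}, independent S -> #|S| < n - d) ->
  #|indep_sets G| < 2 ^ (n - d).
Proof.
move=> d_gt0 n_large [nG dG] small.
have indepE : indep_sets G = indep_in [set: G].
  by apply/setP => S; rewrite !inE subsetT andbT.
have [le_k|[U cU iU]] := matching_or_cover (3 * d) [set: G].
  rewrite -indepE cardsT nG !expnM in le_k.
  (* The matching costs the factor [(27/64) ^ d]; since [2 * 27 < 64], this beats the [2 ^ d]
     between [2 ^ n] and [2 ^ (n - d)]. *)
  have n_split : 2 ^ n = 2 ^ d * 2 ^ (n - d) by rewrite -expnD subnKC //; lia.
  rewrite n_split mulnA -expnMn in le_k.
  rewrite -(@ltn_pmul2l ((4 ^ 3) ^ d)) ?expn_gt0 //.
  apply: leq_ltn_trans le_k _; rewrite ltn_pmul2r ?expn_gt0 //.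
  by rewrite ltn_exp2r.
rewrite setTD in iU.
(* With this threshold, the independent sets meeting [H] number less than a quarter of
   [2 ^ (n - d)], because [6 d < 8 * 2 ^ d]. *)
pose H := [set v in U | 2 * d + 4 <= degree v].
have HU : #|H| <= #|U| by apply/subset_leq_card/subsetP => v; rewrite inE => /andP[].
have hitH : \sum_(v in H) #|[set S in indep_sets G | v \in S]| <=
    6 * d * 2 ^ (n - (2 * d + 5)).
  apply: (@leq_trans (\sum_(v in H) 2 ^ (n - (2 * d + 5)))).
    apply: leq_sum => v; rewrite inE => /andP[_ hv].
    by apply: leq_trans (card_indep_containing v) _; rewrite leq_exp2l // nG; lia.
  by rewrite sum_nat_const leq_mul2r; apply/orP; right; lia.
have {}hitH : 8 * \sum_(v in H) #|[set S in indep_sets G | v \in S]| < 2 * 2 ^ (n - d).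
  have -> : n - d = (n - (2 * d + 5)) + d + 5 by lia.
  have := ltn_expl d (isT : 1 < 2); rewrite !expnD.
  have := expn_gt0 2 (n - (2 * d + 5)); nia.
have Hd : d <= #|H|.
  rewrite leqNgt; apply/negP => lt_d.
  (* A vertex outside [U] has at least [d] neighbours, all in [U], so one of them is not in [H]. The
     low-degree vertices of [U] would then dominate the rest, giving [n <= 6 d + 6 d (2 d + 3)]. *)
  have cover : ~: U \subset \bigcup_(u in U :\: H) [set w : G | adj u w].
    apply/subsetP => v; rewrite inE => vU.
    have /subsetPn[u] : ~~ ([set w : G | adj v w] \subset H).
      apply: contraTN (dG v) => /subset_leq_card.
      by rewrite -ltnNge => /leq_ltn_trans; apply.
    rewrite inE => vu uH; apply/bigcupP; exists u; last by rewrite inE adj_sym.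
    rewrite inE uH andTb; apply: contraTT vu => uU.
    by have /independentP := iU; apply; rewrite inE.
  have := leq_trans (subset_leq_card cover) (card_bigcup_le _ _).
  rewrite cardsCs setCK nG; apply/negP; rewrite -ltnNge.
  apply: (@leq_ltn_trans (\sum_(u in U :\: H) (2 * d + 3))).
    apply: leq_sum => u; rewrite !inE => /andP[uH uU].
    by move: uH; rewrite uU /degree; lia.
  rewrite sum_nat_const; have := subset_leq_card (subsetDl U H); nia.
apply: leq_ltn_trans (card_indep_in_setC_le H) _.
have cHC : #|~: H| = n - #|H| by rewrite cardsCs setCK nG.
(* Three quarters remain for the sets avoiding [H]. If [H] has exactly [d] vertices, its complement
   is too large to be independent; otherwise the complement has fewer than [n - d] vertices. *)
suff : 4 * #|indep_in (~: H)| <= 3 * 2 ^ (n - d) by lia.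
have [dH|] := eqVneq #|H| d.
  rewrite -dH -cHC; apply: card_indep_in_dependent.
  by apply/negP => /small; rewrite cHC dH ltnn.
rewrite neq_ltn ltnNge Hd /= => lt_dH.
apply: (@leq_trans (2 * 2 ^ (n - d))); last by rewrite leq_mul2r orbT.
apply: leq_trans (leq_mul (leqnn 4) (card_indep_in_le _)) _.
rewrite cHC -[4]/(2 * 2) -mulnA leq_pmul2l // -expnS leq_exp2l //.
have : #|H| <= n by rewrite -nG max_card.
by lia.
Qed.

(** * Graphs with an independent set of size [n - d] *)

(** For [S] of size [n - d], this is the excess of level [k] over the binomial, contributed by the
    graph on the other [d] vertices. *)
Definition inner_count (G : sgraph) (S : {set G}) (k : nat) : nat :=
  #|[set A in indep_sets G | (#|A| == k) && (A \subset ~: S)]|.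

(** The neighbours of [x], at least [d] in number, lie in the complement of [S], which has at most
    [d] elements, so they fill it. *)
Lemma large_indep_adj (n d : nat) (G : sgraph) (S : {set G}) (x y : G) :
  min_degree_class n d G -> independent S -> n - d <= #|S| -> d <= n ->
  x \in S -> y \notin S -> adj x y.
Proof.
move=> [nG dG] /independentP iS le_S le_dn xS yS.
have sub : [set w : G | adj x w] \subset ~: S.
  apply/subsetP => w; rewrite !inE => xw; apply: contraL xw; exact: iS.
have /eqP Nx : [set w : G | adj x w] == ~: S.
  rewrite eqEcard sub cardsCs setCK nG (leq_trans _ (dG x)) //.
  by rewrite leq_subCl.
by move: yS; rewrite -finset.in_setC -Nx inE.
Qed.

Lemma large_indep_card (n d : nat) (G : sgraph) (S : {set G}) :
  min_degree_class n d G -> independent S -> n - d <= #|S| -> d < n ->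
  #|S| = n - d.
Proof.
move=> [nG dG] /independentP iS le_S lt_dn; apply/eqP; rewrite eqn_leq le_S andbT.
have /card_gt0P[x xS] : 0 < #|S| by apply: leq_trans le_S; rewrite subn_gt0.
have sub : [set w : G | adj x w] \subset ~: S.
  apply/subsetP => w; rewrite !inE => xw; apply: contraL xw; exact: iS.
have := leq_trans (dG x) (subset_leq_card sub).
by rewrite cardsCs setCK nG; have := max_card S; rewrite nG; lia.
Qed.

(** All edges between [S] and its complement are present, so an independent set lies on one side.
    Taking [k > 0] keeps the empty set from being counted on both sides. *)
Lemma large_indep_count (n d : nat) (G : sgraph) (S : {set G}) (k : nat) :
  min_degree_class n d G -> independent S -> n - d <= #|S| -> d < n -> 0 < k ->
  indep_count G k = 'C(n - d, k) + inner_count S k.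
Proof.
move=> cG iS le_S lt_dn k_gt0.
rewrite -(large_indep_card cG iS le_S lt_dn) -cards_draws.
set P := [set A : {set G} | _].
set Q := [set A in indep_sets G | (#|A| == k) && (A \subset ~: S)].
have disj : [disjoint P & Q].
  rewrite disjoint_subset; apply/subsetP => A; rewrite !inE => /andP[sAS /eqP kA].
  apply/negP => /and3P[_ _ sAC].
  have /card_gt0P[x xA] : 0 < #|A| by rewrite kA.
  by have := subsetP sAC x xA; rewrite inE (subsetP sAS).
have := leq_card_setU P Q; rewrite disj => /leqifP/eqP <-.
apply: eq_card => A; rewrite !inE.
have [kA|] /= := eqVneq #|A| k; last by rewrite !andbF.
rewrite !andbT; apply/idP/orP => [iA|[sAS|/andP[]//]]; last exact: sub_independent iS.
have [sAC|/subsetPn[x xA]] := boolP (A \subset ~: S); first by right; rewrite iA.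
rewrite inE negbK => xS; left; apply/subsetP => y yA; apply: contraLR xA => yS.
apply/negP => xA; have /independentP/(_ x y xA yA) := iA.
by rewrite (large_indep_adj cG iS le_S (ltnW lt_dn) xS yS).
Qed.

(** * The graph [Kstar] and its recognition *)

Lemma Kstar_indep_half (d m : nat) :
  exists2 S : {set Kstar d m}, independent S & #|S| = m /\
    forall k, 2 <= k -> inner_count S k = 0.
Proof.
pose S : {set Kstar d m} := [set x : 'I_d + 'I_m | if x is inr _ then true else false].
exists S.
  by apply/independentP => -[i|i] [j|j]; rewrite !inE.
split.
  rewrite -[RHS]card_ord -cardsT -(card_imset _ (@inr_inj 'I_d 'I_m)).
  apply: eq_card => -[i|i]; rewrite !inE; apply/esym.
    by apply/negbTE/imsetP => -[].
  by rewrite imset_f.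
move=> k k_ge2; apply/eqP; rewrite cards_eq0; apply/eqP/setP => A; rewrite !inE.
apply/negP => /and3P[iA /eqP kA sAC].
have /card_gt1P[x [y [xA yA xy]]] : 1 < #|A| by rewrite kA.
have := subsetP sAC x xA; have := subsetP sAC y yA; rewrite !inE.
have /independentP/(_ x y xA yA) := iA.
case: x y xy {xA yA} => [i|i] [j|j] xy //= /negP + _ _; apply; exact: xy.
Qed.

Lemma Kstar_class (n d : nat) : d <= n ->
  0 < n - d -> min_degree_class n d (Kstar d (n - d)).
Proof.
move=> le_dn m_gt0; split; first by rewrite card_sum !card_ord subnKC.
move=> v; rewrite /degree.
(* An injection into the neighbours of [v]: the clique itself, with [v], if it lies there, replaced
   by a vertex of the edgeless side. *)
pose f (i : 'I_d) : 'I_d + 'I_(n - d) :=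
  if v is inl j then (if i == j then inr (Ordinal m_gt0) else inl i) else inl i.
have f_inj : injective f.
  rewrite /f; case: v {f} => [v|v] i j; last by case.
  by do 2!case: eqP => [->|_]; rewrite // => -[].
rewrite -[leqLHS]card_ord -cardsT -(card_imset _ f_inj).
apply/subset_leq_card/subsetP => _ /imsetP[i _ ->]; rewrite inE /f /=.
by case: v {f f_inj} => [v|v] //=; case: eqVneq => //=; rewrite eq_sym.
Qed.

(** Without an independent pair outside [S], the complement is a clique, completely joined to
    [S]. *)
Lemma isomorphic_Kstar (n d : nat) (G : sgraph) (S : {set G}) :
  min_degree_class n d G -> independent S -> n - d <= #|S| -> d < n ->
  inner_count S 2 = 0 -> isomorphic G (Kstar d (n - d)).
Proof.
move=> cG iS le_S lt_dn; have [nG _] := cG.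
have cS := large_indep_card cG iS le_S lt_dn.
have cC : #|~: S| = d by rewrite cardsCs setCK nG cS subKn // ltnW.
move/eqP; rewrite cards_eq0 => /eqP h0.
have clique x y : x \notin S -> y \notin S -> x != y -> adj x y.
  move=> xS yS xy; apply: contraT => nxy.
  have := in_set0 [set x; y]; rewrite -h0 !inE cards2 xy eqxx /=.
  have -> : [set x; y] \subset ~: S by apply/subsetP => z /set2P[]->; rewrite inE.
  suff -> : independent [set x; y] by [].
  by apply/independentP => u v /set2P[]-> /set2P[]->; rewrite ?adj_irrefl ?nxy // adj_sym.
pose g (u : 'I_d + 'I_(n - d)) : G :=
  match u with
  | inl i => enum_val (cast_ord (esym cC) i)
  | inr j => enum_val (cast_ord (esym cS) j)
  end.
have gl i : g (inl i) \notin S by have := enum_valP (cast_ord (esym cC) i); rewrite inE.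
have gr j : g (inr j) \in S by exact: enum_valP.
have g_inj : injective g.
  move=> [i|i] [j|j] //=; try by move=> /enum_val_inj/cast_ord_inj->.
    by move=> e; have := gl i; rewrite /= e gr.
  by move=> e; have := gl j; rewrite /= -e gr.
have [|f fg gf] := inj_card_bij g_inj; first by rewrite card_sum !card_ord nG; lia.
have adj_g (u v : 'I_d + 'I_(n - d)) : Kstar_adj u v = adj (g u) (g v).
  have /independentP iS' := iS.
  case: u v => [i|i] [j|j].
  - have [->|ij] := eqVneq i j; first by rewrite /= eqxx adj_irrefl.
    by rewrite /Kstar_adj ij clique ?gl // (inj_eq g_inj).
  - by rewrite adj_sym (large_indep_adj cG iS le_S (ltnW lt_dn) (gr _) (gl _)).
  - by rewrite (large_indep_adj cG iS le_S (ltnW lt_dn) (gr _) (gl _)).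
  - by rewrite (negbTE (iS' _ _ (gr _) (gr _))).
by exists f => [|x y]; [exists g | rewrite /= adj_g !gf].
Qed.

(** * Comparison of the tail probabilities *)

Lemma sum_from2 (N : nat) (F : nat -> nat) : 0 < N ->
  \sum_(0 <= k < N.+1) F k = F 0 + (F 1 + \sum_(2 <= k < N.+1) F k).
Proof. by move=> N_gt0; rewrite big_ltn // big_ltn. Qed.

Lemma sum_split_tail (N t : nat) (F : nat -> nat) : t <= N ->
  \sum_(0 <= k < N.+1) F k = \sum_(0 <= k < t) F k + \sum_(t <= k < N.+1) F k.
Proof. by move=> tN; rewrite (big_cat_nat (n := t)) // leqW. Qed.

Lemma prob_indep_size_lt (R : realType) (G K : sgraph) (t : nat) :
  #|[set S in indep_sets G | t <= indep_size S]| * #|indep_sets K| <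
    #|[set S in indep_sets K | t <= indep_size S]| * #|indep_sets G| ->
  (prob_indep_size_ge R G t < prob_indep_size_ge R K t)%R.
Proof.
have pos (H : sgraph) : 0 < #|indep_sets H|.
  by apply/card_gt0P; exists set0; rewrite inE independent0.
move=> lt_AB; rewrite /prob_indep_size_ge /unif_prob.
rewrite ltr_pdivrMr ?ltr0n // mulrAC ltr_pdivlMr ?ltr0n //.
by rewrite -!natrM ltr_nat.
Qed.

Lemma Kstar_count (n d k : nat) : d < n -> 2 <= k ->
  indep_count (Kstar d (n - d)) k = 'C(n - d, k).
Proof.
move=> lt_dn k2; have [S iS [cS in0]] := Kstar_indep_half d (n - d).
have cK : min_degree_class n d (Kstar d (n - d)).
  by apply: Kstar_class; rewrite ?subn_gt0 // ltnW.
by rewrite (large_indep_count cK iS) ?cS ?in0 ?addn0 // (leq_trans _ k2).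
Qed.

Lemma no_large_indep_lt (R : realType) (n d t : nat) (G : sgraph) :
  0 < d -> 12 * d ^ 2 + 30 * d < n -> min_degree_class n d G ->
  (forall S : {set G}, independent S -> #|S| < n - d) ->
  1 <= t <= n - d ->
  (prob_indep_size_ge R G t < prob_indep_size_ge R (Kstar d (n - d)) t)%R.
Proof.
move=> d_gt0 n_large cG small /andP[t_gt0 tm]; have [nG _] := cG.
have lt_dn : d < n by lia.
have [nK _] : min_degree_class n d (Kstar d (n - d)).
  by apply: Kstar_class; lia.
set m := n - d in small tm *.
have mn : m <= n by apply: leq_subr.
have tn : t <= n by apply: leq_trans mn.
have n_gt0 : 0 < n by apply: leq_trans lt_dn.
have am0 : indep_count G m = 0.
  apply/eqP; rewrite cards_eq0; apply/eqP/setP => S; rewrite !inE.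
  by apply/negbTE/negP => /andP[/small lt_S /eqP cS]; rewrite cS ltnn in lt_S.
have ratio : forall j k, 0 < j -> j <= k ->
    indep_count G k * 'C(m, j) <= 'C(m, k) * indep_count G j.
  by apply: ratio_mono => k; apply: indep_count_step.
(* Levels 0 and 1 give [1 + n] for [G] but only [1 + m] in the binomial row, so the bound [2 ^ m] on
   the total passes to levels from 2 on. *)
have tail2 : \sum_(2 <= k < n.+1) indep_count G k < \sum_(2 <= k < n.+1) 'C(m, k).
  have := card_indep_sets_lt d_gt0 n_large cG small.
  rewrite card_indep_setsE nG sum_from2 // indep_count0 indep_count1 nG.
  by rewrite -/m -(sum_bin mn) (sum_from2 _ n_gt0) bin0 bin1; lia.
have KE t' : 2 <= t' -> \sum_(t' <= k < n.+1) indep_count (Kstar d m) k =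
    \sum_(t' <= k < n.+1) 'C(m, k).
  move=> t'2; apply: eq_big_nat => k /andP[t'k _].
  by apply: Kstar_count => //; apply: leq_trans t'k.
apply: prob_indep_size_lt; rewrite !card_indep_setsE !indep_tailE nG nK.
(* The products of the two tails cancel; each tail is left multiplied by the other graph's head. *)
rewrite !(sum_split_tail _ tn) !mulnDr [X in _ < _ + X]mulnC ltn_add2r.
have [t_le1|t2] := leqP t 1.
  have -> : t = 1 by lia.
  rewrite !big_nat1 !indep_count0 !muln1 !(@big_ltn _ _ _ 1) ?ltnS //.
  by rewrite !indep_count1 nG nK ltn_add2l KE.
have lt_t := tail_lt ratio mn am0 (introT andP (conj t2 tm)) tail2.
have low F : \sum_(0 <= k < t) F k = F 0 + (F 1 + \sum_(2 <= k < t) F k).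
  by rewrite big_ltn // big_ltn.
(* The common part [1 + n] of the heads gives strictness; the levels from 2 to [t - 1] are compared
   pairwise by [ratio]. *)
rewrite !low !indep_count0 !indep_count1 nG nK KE // !addnA !mulnDr.
rewrite -addSn leq_add //.
  by rewrite -!mulnDr ltn_pmul2r // add1n.
have -> : \sum_(2 <= k < t) indep_count (Kstar d m) k = \sum_(2 <= k < t) 'C(m, k).
  by apply: eq_big_nat => k /andP[k2 _]; apply: Kstar_count.
rewrite !big_distrl /=; apply: leq_sum_nat => k /andP[tk _].
rewrite !big_distrr /=; apply: leq_sum_nat => j /andP[j2 jt].
by apply: ratio; [apply: leq_trans j2|apply/ltnW/(leq_trans jt)].
Qed.

Lemma large_indep_lt (R : realType) (n d t : nat) (G : sgraph) (S : {set G}) :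
  0 < d -> 12 * d ^ 2 + 30 * d < n -> min_degree_class n d G ->
  independent S -> n - d <= #|S| ->
  ~ isomorphic G (Kstar d (n - d)) ->
  3 <= t <= n - d ->
  (prob_indep_size_ge R G t < prob_indep_size_ge R (Kstar d (n - d)) t)%R.
Proof.
move=> d_gt0 n_large cG iS le_S niso /andP[t3 tm]; have [nG _] := cG.
have lt_dn : d < n by lia.
have [nK _] : min_degree_class n d (Kstar d (n - d)).
  by apply: Kstar_class; lia.
have cS := large_indep_card cG iS le_S lt_dn.
have h2 : 0 < inner_count S 2.
  rewrite lt0n; apply/eqP => h20; exact/niso/(isomorphic_Kstar cG iS le_S lt_dn h20).
set m := n - d in tm cS *.
have mn : m <= n by apply: leq_subr.
have tn : t <= n by apply: leq_trans mn.
have n_gt0 : 0 < n by apply: leq_trans lt_dn.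
have t2 : 2 <= t by apply: ltnW.
apply: prob_indep_size_lt; rewrite !card_indep_setsE !indep_tailE nG nK.
pose B u := \sum_(u <= k < n.+1) 'C(m, k).
pose h u := \sum_(u <= k < n.+1) inner_count S k.
have KE u : 2 <= u -> \sum_(u <= k < n.+1) indep_count (Kstar d m) k = B u.
  move=> u2; apply: eq_big_nat => k /andP[uk _].
  by apply: Kstar_count => //; apply: leq_trans uk.
have GE u : 2 <= u -> \sum_(u <= k < n.+1) indep_count G k = B u + h u.
  move=> u2; rewrite /B /h -big_split /=; apply: eq_big_nat => k /andP[uk _].
  by rewrite (large_indep_count cG iS) // (leq_trans _ uk) // ltnW.
have totB : 1 + (m + B 2) = 2 ^ m.
  by rewrite -(sum_bin mn) (sum_from2 _ n_gt0) bin0 bin1.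
have splitB : \sum_(0 <= k < t) 'C(m, k) + B t = 2 ^ m.
  by rewrite -(sum_bin mn) (sum_split_tail _ tn).
have B_gt0 : 0 < B t.
  rewrite /B (big_cat_nat tm) /=; last by rewrite leqW.
  by rewrite [X in _ + X]big_ltn ?ltnS // binn; lia.
have h_lt : h t < h 2.
  rewrite {2}/h (big_cat_nat t2) /=; last by rewrite leqW.
  by rewrite big_ltn // -/(h t); lia.
have h_le : h 2 <= 2 ^ d.
  have cC : #|~: S| = d by rewrite cardsCs setCK nG cS /m; lia.
  have := card_indep_in_le (~: S); rewrite cC; apply: leq_trans.
  have -> : h 2 = #|[set A in indep_in (~: S) | 2 <= #|A|]|.
    rewrite (card_level_sum _ _ (N := n)); last by move=> A; rewrite -nG max_card.
    apply: eq_bigr => k _; apply: eq_card => A; rewrite !inE.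
    by rewrite [_ && (A \subset _)]andbC andbA.
  by apply/subset_leq_card/subsetP => A; rewrite inE => /andP[].
rewrite !(sum_from2 _ n_gt0) !indep_count0 !indep_count1 nG nK !KE // !GE //.
have -> : 1 + (n + B 2) = 2 ^ m + d by rewrite -totB /m; lia.
have -> : 1 + (n + (B 2 + h 2)) = 2 ^ m + d + h 2 by rewrite -totB /m; lia.
(* What remains is [h t * (2 ^ m + d) < B t * h 2]. *)
rewrite mulnDl [ltnRHS]mulnDr ltn_add2l.
have [ht0|ht_gt0] := posnP (h t).
  by rewrite ht0 mul0n muln_gt0 B_gt0 (leq_ltn_trans _ h_lt).
have td : t <= d.
  rewrite leqNgt; apply/negP => lt_dt; move: ht_gt0; rewrite lt0n => /eqP; apply.
  rewrite /h big_nat big1 // => k /andP[tk _]; apply/eqP; rewrite cards_eq0.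
  apply/eqP/setP => A; rewrite !inE; apply/negbTE/and3P => -[_ /eqP kA sA].
  have := subset_leq_card sA; rewrite kA cardsCs setCK nG cS /m => le_k.
  by have := leq_trans tk le_k; lia.
have low : 2 ^ (d + 2) * \sum_(0 <= k < t) 'C(m, k) <= 2 ^ m.
  apply: leq_trans (sum_bin_small (m := m) (d := d) (j := d + 2) _).
    by rewrite leq_mul2l [X in _ <= X](@big_cat_nat _ _ _ t) //= leq_addr orbT.
  by rewrite /m; lia.
have dpow : 2 ^ d * 2 ^ d * 2 <= 2 ^ m.
  by rewrite -expnD -expnSr leq_exp2l // /m; lia.
have d_lt : d < 2 ^ d by apply: ltn_expl.
rewrite expnD in low.
move: low splitB; set s := \sum_(0 <= k < t) _ => low splitB.
(* With [s = 2 ^ m - B t], it suffices that [h t * d + (h t + 1) * s < 2 ^ m]. The second term is at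
   most a quarter of [2 ^ m] by [low], and the first is below half of it by [dpow]. *)
apply: (@leq_trans (B t * (h t).+1)); last by rewrite leq_mul2l h_lt orbT.
have hd : (h t).+1 <= 2 ^ d := leq_trans h_lt h_le.
have e1 : (h t).+1 * s <= 2 ^ d * s by rewrite leq_mul2r hd orbT.
have e2 : (h t).+1 * d <= 2 ^ d * d by rewrite leq_mul2r hd orbT.
have e3 : 2 ^ d * d.+1 <= 2 ^ d * 2 ^ d by rewrite leq_mul2l d_lt orbT.
rewrite -splitB in low dpow *.
nia.
Qed.

(** * The growth condition and the theorem *)

Local Open Scope classical_set_scope.
Local Open Scope ring_scope.

Lemma little_o_cuberoot (R : realType) (d : nat -> nat) (c : nat) :
  (fun n : nat => (d n)%:R : R) =o_\oo (fun n : nat => (n%:R : R) `^ (3^-1)) ->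
  exists N, forall n, (N <= n)%N -> (c ^ 3 * d n ^ 3 <= n)%N.
Proof.
move=> d_little.
(* The successor keeps the constant positive for [c = 0] too. *)
have c_gt0 : (0 : R) < c.+1%:R^-1 by rewrite invr_gt0 ltr0n.
have /eqoP/(_ _ c_gt0) := d_little => -[N _ hN].
exists N => n /hN /=.
rewrite !ger0_norm ?powR_ge0 ?ler0n // ler_pdivlMl ?ltr0n //.
rewrite -natrM => le_root; rewrite -expnMn.
apply: (@leq_trans ((c.+1 * d n) ^ 3)).
  by rewrite leq_exp2r // leq_mul2r leqnSn orbT.
rewrite -(ler_nat R) natrX.
have -> : n%:R = (n%:R `^ 3^-1) ^+ 3 :> R.
  by rewrite -powR_mulrn ?powR_ge0 // -powRrM mulVf ?powRr1 ?pnatr_eq0.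
by rewrite lerXn2r ?nnegrE ?powR_ge0 ?ler0n.
Qed.

Theorem theorem2 (R : realType) (d : nat -> nat)
    (d_ge1 : forall n : nat, (1 <= d n)%N)
    (d_little : (fun n : nat => (d n)%:R : R) =o_\oo
                (fun n : nat => (n%:R : R) `^ (3^-1))) :
  exists N : nat, forall n : nat, (N <= n)%N ->
  forall G : sgraph, min_degree_class n (d n) G ->
  ~ isomorphic G (Kstar (d n) (n - d n)) ->
  (forall t : nat, (3 <= t <= n - d n)%N ->
     prob_indep_size_ge R G t
       < prob_indep_size_ge R (Kstar (d n) (n - d n)) t)
  /\ ((independence_number G < n - d n)%N ->
      forall t : nat, (1 <= t <= 2)%N ->
        prob_indep_size_ge R G t
          < prob_indep_size_ge R (Kstar (d n) (n - d n)) t).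
Proof.
(* The constant 4 suffices: [12 d^2 + 30 d <= 42 d^3 < 64 d^3 <= n] for [d >= 1]. *)
have [N hN] := @little_o_cuberoot R d 4 d_little.
exists N => n /hN le_n G cG niso.
have d_gt0 := d_ge1 n.
have n_large : (12 * d n ^ 2 + 30 * d n < n)%N by move: le_n d_gt0; clear; nia.
have le_alpha (S : {set G}) : independent S -> (#|S| <= independence_number G)%N.
  by move=> iS; apply: (leq_bigmax_cond (F := fun A : {set G} => #|A|) S); rewrite inE.
split=> [t tm|alpha_lt t /andP[t1 t2]].
  have [[S [iS le_S]]|small] :=
      pselect (exists S : {set G}, independent S /\ (n - d n <= #|S|)%N).
    exact: large_indep_lt iS le_S niso tm.
  apply: no_large_indep_lt => //.
    by move=> S iS; rewrite ltnNge; apply/negP => le_S; apply: small; exists S.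
  by case/andP: tm => t3 ->; rewrite andbT; apply: leq_trans t3.
apply: no_large_indep_lt => //; last by move: n_large d_gt0 t1 t2; clear; nia.
by move=> S /le_alpha/leq_ltn_trans; apply.
Qed.
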